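(* Let $q$ be an indeterminate and for every integer $k\ge 0$ let \[ c_q(k)=(-1)^k \frac{(q;q^2)_k\, (-q;q^2)_k^2}{(q^4;q^4)_k\, (-q^4;q^4)_k^2}\, [6k+1]\, q^{3k^2}, \] and \[ a_q(k)=\sum_{j=0}^{k} c_q(j)\, c_q(k-j). \] Then for every positive odd integer $n$, \[ \sum_{k=0}^{n-1} a_q(k)\equiv 0 \pmod{[n]}. \]
   Context: The $q$-shifted factorial is $(a;q)_0=1$ and $(a;q)_n=\prod_{i=0}^{n-1}(1-aq^i)$ for $n\ge1$. The $q$-integer is $[n]=[n]_q=\frac{1-q^n}{1-q}=1+q+\cdots+q^{n-1}$. For polynomials $A_1(q),A_2(q),P(q)\in\mathbb{Z}[q]$, the congruence $\frac{A_1(q)}{A_2(q)}\equiv 0 \pmod{P(q)}$ means that $P(q)$ divides $A_1(q)$ and $\gcd(P(q),A_2(q))=1$; for rational functions $A(q),B(q)\in\mathbb{Z}(q)$, $A(q)\equiv B(q)\pmod{P(q)}$ means $A(q)-B(q)\equiv 0\pmod{P(q)}$. *)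

(* Defs.v *)
From HB Require Import structures.
From mathcomp Require Import all_boot all_order all_algebra.
Set Implicit Arguments.
Unset Strict Implicit.
Unset Printing Implicit Defensive.
Import GRing.Theory.
Local Open Scope ring_scope.

Definition qpoch (R : comPzRingType) (a q : R) (n : nat) : R :=
  \prod_(i < n) (1 - a * q ^+ i).

(* Division-free form of (1 - q^n) / (1 - q), so that the same definition is
   used in Z[q] and in Z(q). *)
Definition qint (R : comPzRingType) (q : R) (n : nat) : R :=
  \sum_(i < n) q ^+ i.

Lemma qintE (F : fieldType) (q : F) (n : nat) :
  q != 1 -> qint q n = (1 - q ^+ n) / (1 - q).
Proof.
move=> q1; have h : 1 - q != 0 by rewrite subr_eq0 eq_sym.
by apply: (mulIf h); rewrite divfK // mulrC -[1 - q ^+ n]opprB subrX1 -mulNr opprB.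
Qed.

(* MathComp's dvdp, gcdp and coprimep work up to nonzero constants, that is, in
   Q[q]; the two notions below are the ones of the ring Z[q] itself. *)
Definition zdvdp (D A : {poly int}) : Prop := exists B : {poly int}, A = B * D.

Definition zcoprimep (A B : {poly int}) : Prop :=
  forall D : {poly int}, zdvdp D A -> zdvdp D B -> D \is a GRing.unit.

Notation ratfun := {fraction {poly int}}.
Local Notation "x %:F" := (tofrac x) : ring_scope.

Definition qvar : ratfun := 'X%:F.

(* By factoriality of Z[q], the congruence holds for some representation of A
   as a fraction A1 / A2 iff it holds for the reduced one. *)
Definition ratfun_cong0 (A : ratfun) (P : {poly int}) : Prop :=
  exists A1 A2 : {poly int},
    [/\ A2 != 0, A = A1%:F / A2%:F, zdvdp P A1 & zcoprimep P A2].

Definition ratfun_cong (A B : ratfun) (P : {poly int}) : Prop :=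
  ratfun_cong0 (A - B) P.

Definition cq (k : nat) : ratfun :=
  let q := qvar in
  (-1) ^+ k
  * (qpoch q (q ^+ 2) k * qpoch (- q) (q ^+ 2) k ^+ 2
     / (qpoch (q ^+ 4) (q ^+ 4) k * qpoch (- (q ^+ 4)) (q ^+ 4) k ^+ 2))
  * qint q (6 * k + 1)%N * q ^+ (3 * k ^ 2)%N.

Definition aq (k : nat) : ratfun := \sum_(j < k.+1) cq j * cq (k - j)%N.

(* Main.v *)
(* It suffices to work at a primitive d-th root of unity z with d | n, d > 1,
   since the reduced denominators of the c_q(k) only involve factors 1 + q^j,
   which do not vanish at roots of unity of odd order.  At z one has
   c(l d + k) = C(l) c(k) for k < d, and c(k) = 0 for (d-1)/2 < k < d, so the
   convolution sum vanishes as soon as the sum of c(k) over k <= (d-1)/2 does.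
   The latter is the case a = z, b = -z, p = z^2 of a terminating quadratic
   summation: with a = p^(-m) and
     U(a,b,k) = (1 - a p^(3k)) (a, b, p/b; p)_k
                / (p^2, a p^2/b, a b p; p^2)_k (-a)^k p^(k(3k-1)/2),
   the difference (1 - a b p) U(a,b,k) - (1 - a) U(ap,bp,k) telescopes in k,
   which reduces m to m - 1 and ends at the trivial case m = 0. *)
Require Import Defs.
From mathcomp Require Import all_boot all_order all_algebra.
From mathcomp Require Import all_field.
From mathcomp Require Import ring zify.
Set Implicit Arguments.
Unset Strict Implicit.
Unset Printing Implicit Defensive.
Import GRing.Theory Num.Theory.
Local Open Scope ring_scope.

(** * A terminating quadratic well-poised summation *)

Section WellPoisedSum.

Variable F : fieldType.

(* Numerators and denominators with p/b and a p^2/b are multiplied by b. *)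
Definition wp_coef (a b p : F) (k : nat) : F :=
  \prod_(i < k)
    ((1 - a * p ^+ i) * (1 - b * p ^+ i) * (b - p * p ^+ i)
       * (- a * p * (p ^+ i) ^+ 3)
     / ((1 - (p * p ^+ i) ^+ 2) * (b - a * (p * p ^+ i) ^+ 2)
       * (1 - a * b * p * (p ^+ i) ^+ 2))).

Lemma wp_coefS a b p k :
  wp_coef a b p k.+1 = wp_coef a b p k *
    ((1 - a * p ^+ k) * (1 - b * p ^+ k) * (b - p * p ^+ k)
       * (- a * p * (p ^+ k) ^+ 3)
     / ((1 - (p * p ^+ k) ^+ 2) * (b - a * (p * p ^+ k) ^+ 2)
       * (1 - a * b * p * (p ^+ k) ^+ 2))).
Proof. by rewrite /wp_coef big_ord_recr. Qed.

Definition wp_term (a b p : F) (k : nat) : F :=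
  (1 - a * (p ^+ k) ^+ 3) * wp_coef a b p k.

(* The Wilf-Zeilberger certificate for the shift (a, b) -> (a p, b p). *)
Definition wp_cert (a b p : F) (k : nat) : F :=
  - (1 - a * b * p) * wp_coef a b p k
    * (1 - (p ^+ k) ^+ 2) * (b - a * (p ^+ k) ^+ 2) / (b - p ^+ k).

Variable d : nat.
Hypothesis d_gt0 : (0 < d)%N.
Hypothesis two_neq0 : (-1 : F) != 1.

(** Source of the nonvanishing of every denominator involving [b]: [a] and the powers of [p] have
    [d]-th power 1, while [b] has [d]-th power -1. *)
Lemma root_neq (x y : F) : x ^+ d = 1 -> y ^+ d = -1 -> x != y.
Proof. by move=> hx hy; apply: contraNneq two_neq0 => e; rewrite -hy -e hx. Qed.

Variable p : F.
Hypothesis pd : p ^+ d = 1.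

Lemma pkd k : (p ^+ k) ^+ d = 1.
Proof. by rewrite exprAC pd expr1n. Qed.

Lemma pkd2 k : ((p ^+ k) ^+ 2) ^+ d = 1.
Proof. by rewrite -(exprM p) pkd. Qed.

Lemma p_neq0 : p != 0.
Proof. by apply: contra_eq_neq pd => ->; rewrite expr0n gtn_eqF //= eq_sym oner_neq0. Qed.

Section Nonvanishing.
Variables a b : F.
Hypotheses (ad : a ^+ d = 1) (bd : b ^+ d = -1).

Lemma wp_nz1 k : b - p ^+ k != 0.
Proof. by rewrite subr_eq0 eq_sym root_neq ?pkd. Qed.

Lemma wp_nz2 k : b - a * (p ^+ k) ^+ 2 != 0.
Proof. by rewrite subr_eq0 eq_sym root_neq // exprMn ad mul1r pkd2. Qed.

Lemma wp_nz3 k : 1 - a * b * p * (p ^+ k) ^+ 2 != 0.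
Proof.
rewrite subr_eq0 root_neq ?expr1n // 3!exprMn ad bd pd pkd2.
by rewrite !mulr1 mul1r.
Qed.

(** Shifting [a] and [b] by [p] moves the index of each product by one, so only boundary factors
    survive. The factor [1 - a] stays on the left because it may vanish. *)
Lemma wp_coef_shift k :
  (1 - a) * wp_coef (a * p) (b * p) p k =
  - wp_coef a b p k * p ^+ k * (1 - a * p ^+ k) * (1 - b * p ^+ k)
    * (1 - a * b * p) / ((b - p ^+ k) * (1 - a * b * p * (p ^+ k) ^+ 2)).
Proof.
elim: k => [|k IH].
  have := wp_nz1 0; have := wp_nz3 0.
  rewrite /wp_coef !big_ord0 !expr0 expr1n !mulr1 => h3 h1; field.
  by rewrite h1 h3.
rewrite !wp_coefS [LHS]mulrA IH.
have := wp_nz1 k; have := wp_nz3 k; have := wp_nz1 k.+1; have := wp_nz3 k.+1.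
have := wp_nz2 k.+1.
rewrite (exprS p k); set x := p ^+ k; set u := wp_coef a b p k => h2 h3' h1' h3 h1.
have h2p : b * p - a * p * (p * x) ^+ 2 != 0.
  rewrite (_ : _ - _ = (b - a * (p * x) ^+ 2) * p); last by ring.
  by rewrite mulf_neq0 // p_neq0.
(* This factor is not known to be nonzero here, but its inverse occurs identically on both sides and
   can be generalized. *)
rewrite !invfM; move: ((1 - (p * x) ^+ 2)^-1) => c.
by field; rewrite ?h1 ?h2 ?h3 ?h1' ?h3' ?h2p.
Qed.

Lemma wp_coef_vanish m k : a * p ^+ m = 1 -> (m < k)%N -> wp_coef a b p k = 0.
Proof.
move=> am mk; rewrite /wp_coef (bigD1 (Ordinal mk)) //= am subrr.
by rewrite !mul0r.
Qed.

(** The certificate vanishes at index 0 through its factor [1 - (p ^+ k) ^+ 2]. In each step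
    [wp_coef a b p N] factors out and a rational identity in [p ^+ N] remains. *)
Lemma wp_telescope N : (forall j, (0 < j <= N)%N -> 1 - (p ^+ j) ^+ 2 != 0) ->
  (1 - a * b * p) * (\sum_(k < N) wp_term a b p k)
    - (1 - a) * (\sum_(k < N) wp_term (a * p) (b * p) p k) = wp_cert a b p N.
Proof.
elim: N => [|N IH] hN.
  by rewrite !big_ord0 /wp_cert !expr0 expr1n subrr !mulr0 !mul0r subrr.
rewrite !big_ord_recr /= [in LHS]mulrDr [X in _ - X]mulrDr opprD addrACA.
rewrite {}IH => [|j /andP[j0 jN]]; last by rewrite hN // j0 leqW.
rewrite /wp_term (mulrCA (1 - a)) wp_coef_shift /wp_cert wp_coefS.
have := wp_nz1 N; have := wp_nz3 N; have := wp_nz1 N.+1.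
have := wp_nz2 N.+1; have := hN N.+1 (leqnn _).
rewrite (exprS p N); set x := p ^+ N => h4 h2 h1' h3 h1.
by field; rewrite ?h1 ?h2 ?h3 ?h1' ?h4.
Qed.

End Nonvanishing.

(** Induction on [m]: the shifted pair satisfies [(a * p) * p ^+ m = 1], and the certificate at [N]
    is 0 since [wp_coef a b p N] is. For [m = 0], [a = 1] and the only surviving term is [1 - a]. *)
Lemma wp_sum_eq0 m N a b : a ^+ d = 1 -> b ^+ d = -1 -> a * p ^+ m = 1 ->
  (m < N)%N -> (forall j, (0 < j <= N)%N -> 1 - (p ^+ j) ^+ 2 != 0) ->
  \sum_(k < N) wp_term a b p k = 0.
Proof.
move=> ad bd am mN hN; elim: m a b ad bd am mN => [|m IH] a b ad bd am mN.
  rewrite mulr1 in am; case: N mN hN => // N _ _.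
  rewrite big_ord_recl big1 => [|i _].
    by rewrite /wp_term am mul1r expr1n subrr mul0r addr0.
  by rewrite /wp_term (@wp_coef_vanish _ _ 0) ?mulr0 // am mulr1.
have := wp_telescope ad bd hN.
rewrite /wp_cert (wp_coef_vanish b am mN) mulr0 !mul0r.
rewrite (IH (a * p) (b * p)) ?exprMn ?ad ?bd ?pd ?mulr1 -1?mulrA -?exprS // 1?ltnW //.
have := wp_nz3 ad bd 0; rewrite expr0 expr1n mulr1 !mulr0 subr0 -mulrA => h /eqP.
by rewrite mulf_eq0 (negPf h) => /eqP.
Qed.

End WellPoisedSum.

(** * Convolution sums of sequences that repeat in blocks up to a factor *)

Section BlockSums.

Variables (R : comPzRingType) (m : nat) (c G : nat -> R).
Let d := m.*2.+1.
Hypothesis c_block : forall l k, (k < d)%N -> c (l * d + k)%N = G l * c k.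
Hypothesis c_vanish : forall k, (m < k < d)%N -> c k = 0.
Hypothesis c_sum0 : \sum_(k < m.+1) c k = 0.

Lemma sum_above_half s : (m < s <= d)%N -> \sum_(k < s) c k = 0.
Proof.
elim: s => // s IH /andP[]; rewrite ltnS leq_eqVlt => /orP[/eqP<-//|ms] sd.
by rewrite big_ord_recr /= IH ?ms ?(ltnW sd) // c_vanish ?ms ?addr0.
Qed.

(** Complete blocks contribute nothing, so only the last, partial block counts. *)
Lemma sum_blocks l s : (s <= d)%N ->
  \sum_(k < l * d + s) c k = G l * \sum_(k < s) c k.
Proof.
have split_block l' s' : (s' <= d)%N -> \sum_(k < l' * d + s') c k =
    \sum_(k < l' * d) c k + G l' * \sum_(k < s') c k.
  move=> hs; rewrite big_split_ord /= mulr_sumr; congr (_ + _).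
  by apply: eq_bigr => i _; rewrite c_block // (leq_trans (ltn_ord i)).
have full l' : \sum_(k < l' * d) c k = 0.
  elim: l' => [|l' IH]; first by rewrite big_ord0.
  rewrite mulSn addnC split_block // IH sum_above_half ?mulr0 ?addr0 //.
  by rewrite leqnn andbT /d -addnn; lia.
by move=> hs; rewrite split_block // full add0r.
Qed.

Lemma convolution_sum n :
  \sum_(k < n) \sum_(j < k.+1) c j * c (k - j)%N
  = \sum_(j < n) c j * \sum_(i < n - j) c i.
Proof.
elim: n => [|n IH]; first by rewrite !big_ord0.
rewrite big_ord_recr /= IH [in RHS]big_ord_recr /= subSn // subnn big_ord1.
rewrite [in LHS](big_ord_recr n) /= subnn addrA; congr (_ + _).
rewrite -big_split; apply: eq_bigr => j _ /=.
by rewrite subSn 1?ltnW // big_ord_recr /= mulrDr.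
Qed.

(* With [j = l d + k], [c j] vanishes unless [k <= m]; then [n - j] is
   congruent to [- k], and the inner sum vanishes. *)
Lemma convolution_sum_eq0 L :
  \sum_(k < L * d) \sum_(j < k.+1) c j * c (k - j)%N = 0.
Proof.
rewrite convolution_sum big1 // => -[j /= jn] _.
have d0 : (0 < d)%N by [].
have kd := ltn_pmod j d0; have lL : (j %/ d < L)%N by rewrite ltn_divLR.
rewrite [in c _](divn_eq j d) c_block //.
have [mk|km] := ltnP m (j %% d).
  by rewrite (c_vanish (k := (j %% d)%N)) ?mk // mulr0 mul0r.
(* The last block has length [d - j %% d], which is more than [m], and is a full [d] when [d]
   divides [j]. *)
have -> : (L * d - j = (L - (j %/ d).+1) * d + (d - j %% d))%N.
  have := subnKC lL; have := divn_eq j d; move: kd.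
  move: (L - (j %/ d).+1)%N (j %/ d)%N (j %% d)%N => x y t kd ej <-.
  by rewrite {1}ej mulnDl mulSn; lia.
rewrite sum_blocks ?leq_subr // sum_above_half ?mulr0 //.
by rewrite leq_subr andbT /d -addnn in km *; lia.
Qed.

End BlockSums.

(** * Central q-binomial coefficients and the denominators of the terms *)

(* The q-binomial coefficient [m + k choose k]. *)
Fixpoint qbin (R : comPzRingType) (q : R) (m k : nat) {struct m} : R :=
  match m with
  | 0 => 1
  | m'.+1 => (fix qbin_m k := match k with
      | 0 => 1
      | k'.+1 => q ^+ k'.+1 * qbin q m' k'.+1 + qbin_m k'
      end) k
  end.

Lemma qbinm0 (R : comPzRingType) (q : R) m : qbin q m 0 = 1.
Proof. by case: m. Qed.

Lemma qbinSS (R : comPzRingType) (q : R) m k :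
  qbin q m.+1 k.+1 = q ^+ k.+1 * qbin q m k.+1 + qbin q m.+1 k.
Proof. by []. Qed.

Lemma rmorph_qpoch (R S : comPzRingType) (f : {rmorphism R -> S}) a q n :
  f (qpoch a q n) = qpoch (f a) (f q) n.
Proof.
rewrite /qpoch rmorph_prod; apply: eq_bigr => i _.
by rewrite rmorphB rmorph1 rmorphM rmorphXn.
Qed.

Lemma rmorph_qint (R S : comPzRingType) (f : {rmorphism R -> S}) q n :
  f (qint q n) = qint (f q) n.
Proof. by rewrite /qint rmorph_sum; apply: eq_bigr => i _; rewrite rmorphXn. Qed.

Lemma rmorph_qbin (R S : comPzRingType) (f : {rmorphism R -> S}) q m k :
  f (qbin q m k) = qbin (f q) m k.
Proof.
elim: m k => [|m IHm]; first by move=> k; rewrite rmorph1.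
elim=> [|k IHk]; first by rewrite !qbinm0 rmorph1.
by rewrite !qbinSS rmorphD rmorphM rmorphXn IHm IHk.
Qed.

Lemma qpochS (R : comPzRingType) (a q : R) n :
  qpoch a q n.+1 = qpoch a q n * (1 - a * q ^+ n).
Proof. by rewrite /qpoch big_ord_recr. Qed.

Lemma qpoch0 (R : comPzRingType) (a q : R) : qpoch a q 0 = 1.
Proof. by rewrite /qpoch big_ord0. Qed.

(** Pascal's rule, with [1 - q ^+ (m + k + 2)] split as [q ^+ k.+1 * (1 - q ^+ m.+1) + (1 - q ^+
    k.+1)]. *)
Lemma qbin_qpoch (R : comPzRingType) (q : R) m k :
  qbin q m k * qpoch q q m * qpoch q q k = qpoch q q (m + k).
Proof.
elim: m k => [|m IHm] k; first by rewrite qpoch0 !mul1r.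
elim: k => [|k IHk]; first by rewrite qbinm0 qpoch0 addn0 mul1r mulr1.
have -> : qpoch q q (m.+1 + k.+1) = qpoch q q (m + k.+1) * (1 - q ^+ m.+1 * q ^+ k.+1).
  by rewrite addSn qpochS -!exprS -exprD addSn.
have e1 := IHm k.+1.
have e2 : qbin q m.+1 k * qpoch q q m.+1 * qpoch q q k
    = qpoch q q (m + k.+1).
  by rewrite IHk addSnnS.
rewrite qbinSS mulrDl mulrDl.
transitivity (q ^+ k.+1 * (1 - q ^+ m.+1) * (qbin q m k.+1 * qpoch q q m * qpoch q q k.+1)
   + (1 - q ^+ k.+1) * (qbin q m.+1 k * qpoch q q m.+1 * qpoch q q k)).
  by rewrite !qpochS -!exprS; ring.
by rewrite e1 e2; ring.
Qed.

Definition ev (R : comNzRingType) (z : R) : {rmorphism {poly int} -> R} :=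
  horner_eval z \o map_poly intr.

Lemma evX (R : comNzRingType) (z : R) : ev z 'X = z.
Proof. by rewrite /= map_polyX /horner_eval hornerX. Qed.

Lemma qpoch_neq0 (a q : {poly int}) k : a.[0] = 0 -> qpoch a q k != 0.
Proof.
move=> a0; apply: (contraTneq _ (oner_neq0 int)) => e.
have : horner_eval 0 (qpoch a q k) = 1.
  rewrite /qpoch rmorph_prod big1 // => i _.
  by rewrite rmorphB rmorph1 rmorphM /= /horner_eval a0 mul0r subr0.
by rewrite e rmorph0 => ->; rewrite eqxx.
Qed.

(** Proved for an indeterminate, where q-factorials can be cancelled; evaluation then carries it to
    roots of unity, where they may vanish. *)
Lemma central_qbinS_poly (k : nat) (q := 'X : {poly int}) :
  (1 - q ^+ k.+1) * qbin q k.+1 k.+1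
  = (1 + q ^+ k.+1) * (1 - q * q ^+ k.*2) * qbin q k k.
Proof.
have qk j : qpoch q q j != 0 by apply: qpoch_neq0; rewrite hornerX.
have hk : 1 - q ^+ k.+1 != 0.
  by have := qk k.+1; rewrite qpochS mulf_eq0 negb_or exprS => /andP[].
apply: (mulfI hk); apply: (mulfI (qk k)); apply: (mulfI (qk k)).
have := qbin_qpoch q k.+1 k.+1; rewrite addSn addnS addnn !qpochS -addnn -qbin_qpoch.
rewrite !exprS exprD => e.
transitivity (qbin q k.+1 k.+1 * (qpoch q q k * (1 - q * q ^+ k))
   * (qpoch q q k * (1 - q * q ^+ k))); first by ring.
by rewrite e; ring.
Qed.

Lemma central_qbinS (R : comNzRingType) (q : R) k :
  (1 - q ^+ k.+1) * qbin q k.+1 k.+1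
  = (1 + q ^+ k.+1) * (1 - q * q ^+ k.*2) * qbin q k k.
Proof.
have := congr1 (ev q) (central_qbinS_poly k).
by rewrite !rmorphM !rmorph_qbin !(rmorphB, rmorphD) rmorph1 !(rmorphM, rmorphXn) evX.
Qed.


Lemma central_qbin_qpoch (R : comNzRingType) (q : R) k :
  qbin q k k * qpoch (q ^+ 2) (q ^+ 2) k
  = qpoch q (q ^+ 2) k * qpoch (- q) q k ^+ 2.
Proof.
elim: k => [|k IH]; first by rewrite !qpoch0 expr1n.
have := central_qbinS q k; rewrite -muln2 mulnC exprM => e.
rewrite !qpochS; rewrite !(exprAC q 2 k) (exprS q k) in e *.
transitivity (((1 - q * q ^+ k) * qbin q k.+1 k.+1)
  * qpoch (q ^+ 2) (q ^+ 2) k * (1 + q * q ^+ k)); first by ring.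
rewrite e; transitivity ((qbin q k k * qpoch (q ^+ 2) (q ^+ 2) k)
  * (1 - q * (q ^+ k) ^+ 2) * (1 + q * q ^+ k) ^+ 2); first by ring.
by rewrite IH; ring.
Qed.

Lemma qpoch_sqr (R : comPzRingType) (q p : R) k :
  qpoch (q ^+ 2) (p ^+ 2) k = qpoch q p k * qpoch (- q) p k.
Proof.
rewrite /qpoch -big_split; apply: eq_bigr => i _ /=.
by rewrite (exprAC p); ring.
Qed.

(** [cq_num / cq_den] is [cq k] without its q-integer: (q^2;q^4)_k / (q^4;q^4)_k is a central
    q-binomial coefficient in base q^2 over (-q^2;q^2)_k^2, so only factors 1 + q^j remain below. *)
Definition cq_num (R : comPzRingType) (q : R) (k : nat) : R :=
  (-1) ^+ k * qbin (q ^+ 2) k k * qpoch (- q) (q ^+ 2) k * q ^+ (3 * k ^ 2)%N.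

Definition cq_den (R : comPzRingType) (q : R) (k : nat) : R :=
  qpoch (- q ^+ 2) (q ^+ 2) k ^+ 2 * qpoch (- q ^+ 4) (q ^+ 4) k ^+ 2.

Lemma rmorph_cq_num (R S : comPzRingType) (f : {rmorphism R -> S}) q k :
  f (cq_num q k) = cq_num (f q) k.
Proof.
by rewrite /cq_num 3!rmorphM !rmorphXn rmorphN1 rmorph_qbin rmorph_qpoch rmorphN !rmorphXn.
Qed.

Lemma rmorph_cq_den (R S : comPzRingType) (f : {rmorphism R -> S}) q k :
  f (cq_den q k) = cq_den (f q) k.
Proof.
by rewrite /cq_den rmorphM 2!rmorphXn 2!rmorph_qpoch !rmorphN !rmorphXn.
Qed.

Lemma cq_den_neq0 k : cq_den ('X : {poly int}) k != 0.
Proof.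
by rewrite mulf_neq0 ?expf_neq0 ?qpoch_neq0 // hornerN hornerXn expr0n oppr0.
Qed.

Lemma cq_quotient (F : fieldType) (q : F) k :
    qpoch (q ^+ 4) (q ^+ 4) k != 0 -> cq_den q k != 0 ->
  (-1) ^+ k * (qpoch q (q ^+ 2) k * qpoch (- q) (q ^+ 2) k ^+ 2
     / (qpoch (q ^+ 4) (q ^+ 4) k * qpoch (- (q ^+ 4)) (q ^+ 4) k ^+ 2))
  * q ^+ (3 * k ^ 2)%N = cq_num q k / cq_den q k.
Proof.
rewrite mulf_eq0 !expf_eq0 /= negb_or => h3 /andP[h1 h2].
have e4 : (q ^+ 2) ^+ 2 = q ^+ 4 by rewrite -exprM.
have := central_qbin_qpoch (q ^+ 2) k; rewrite e4.
have -> : qpoch (q ^+ 2) (q ^+ 4) k = qpoch q (q ^+ 2) k * qpoch (- q) (q ^+ 2) k.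
  by rewrite -e4 qpoch_sqr.
move=> /(canRL (mulfK h3)); rewrite /cq_num /cq_den => ->.
by field; rewrite h1 h2 h3.
Qed.

Lemma cqE k :
  cq k = tofrac (cq_num 'X k * qint 'X (6 * k + 1)) / tofrac (cq_den 'X k).
Proof.
rewrite tofracM rmorph_cq_num rmorph_cq_den rmorph_qint.
rewrite [RHS]mulrAC -cq_quotient; first by rewrite /cq [LHS]mulrAC.
  by rewrite -tofracXn -rmorph_qpoch tofrac_eq0 qpoch_neq0 // hornerXn expr0n.
by rewrite -rmorph_cq_den tofrac_eq0 cq_den_neq0.
Qed.

(** * The terms at roots of unity of odd order *)

Section RootsOfUnity.

Variables (F : fieldType) (n : nat) (z : F).
Hypotheses (n_odd : odd n) (zn : z ^+ n = 1) (two_neq0 : (-1 : F) != 1).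

Lemma odd_root_1D k : 1 + z ^+ k != 0.
Proof.
apply: contra_neq two_neq0 => e.
have e' : z ^+ k = -1 by apply/eqP; rewrite -addr_eq0 addrC e.
have : (z ^+ k) ^+ n = 1 by rewrite exprAC zn expr1n.
by rewrite e' -signr_odd n_odd expr1 => ->.
Qed.

Lemma odd_root_cq_den k : cq_den z k != 0.
Proof.
by rewrite /cq_den /qpoch mulf_neq0 ?expf_neq0 //; apply/prodf_neq0 => i _;
  rewrite mulNr opprK -exprM -exprD odd_root_1D.
Qed.

End RootsOfUnity.

(** Kept free of division, since [1 - q ^+ 2 * x] can vanish at a root of unity. *)
Lemma cq_numS (R : comNzRingType) (q : R) k (x := (q ^+ 2) ^+ k) :
  (1 - (q ^+ 2 * x)) * cq_num q k.+1
  = - (1 + q ^+ 2 * x) * (1 - (q * x) ^+ 2) * (1 + q * x) * (q * x) ^+ 3 * cq_num q k.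
Proof.
have := central_qbinS (q ^+ 2) k; rewrite -muln2 exprM (exprS _ k) -/x => e.
rewrite /cq_num qpochS (exprS _ k) -/x.
have -> : q ^+ (3 * k.+1 ^ 2) = q ^+ (3 * k ^ 2) * (q * x) ^+ 3.
  by rewrite exprMn /x -!exprM -!exprD; congr (_ ^+ _); lia.
transitivity (((1 - q ^+ 2 * x) * qbin (q ^+ 2) k.+1 k.+1)
  * (-1 * (-1) ^+ k * qpoch (- q) (q ^+ 2) k * (1 + q * x) * q ^+ (3 * k ^ 2) * (q * x) ^+ 3)).
  by ring.
by rewrite e; ring.
Qed.

Lemma cq_denS (R : comNzRingType) (q : R) k (x := (q ^+ 2) ^+ k) :
  cq_den q k.+1
  = (1 + q ^+ 2 * x) ^+ 2 * (1 + (q ^+ 2 * x) ^+ 2) ^+ 2 * cq_den q k.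
Proof.
rewrite /cq_den !qpochS.
have -> : (q ^+ 4) ^+ k = x ^+ 2 by rewrite /x -!exprM; congr (_ ^+ _); lia.
by rewrite -/x; ring.
Qed.

Section PrimitiveRoot.

Variables (F : fieldType) (m : nat) (z : F).
Let d := m.*2.+1.
Hypotheses (m_gt0 : (0 < m)%N) (z_prim : d.-primitive_root z).
Hypothesis two_neq0 : (-1 : F) != 1.

Let g k := cq_num z k / cq_den z k.
Let x k := (z ^+ 2) ^+ k.

Let zd : z ^+ d = 1. Proof. exact: prim_expr_order. Qed.
Let d_odd : odd d. Proof. by rewrite /d /= odd_double. Qed.

Lemma prim_sub_neq0 e k : coprime d e -> (0 < k < d)%N -> 1 - z ^+ (e * k) != 0.
Proof.
move=> de /andP[k0 kd]; rewrite subr_eq0 eq_sym -(prim_order_dvd z_prim).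
by rewrite Gauss_dvdr // gtnNdvd.
Qed.

Let d_coprime2 : coprime d 2.
Proof. by rewrite coprime_sym coprime2n. Qed.

Let nz1 k : (k.+1 < d)%N -> 1 - z ^+ 2 * x k != 0.
Proof. by move=> kd; rewrite /x -exprS -exprM prim_sub_neq0. Qed.

Let nz2 k : 1 + z ^+ 2 * x k != 0.
Proof. by rewrite /x -exprM -exprD (odd_root_1D d_odd). Qed.

Let nz3 k : 1 + (z ^+ 2 * x k) ^+ 2 != 0.
Proof. by rewrite /x -exprM -exprD -exprM (odd_root_1D d_odd). Qed.

(** The ratio of consecutive terms depends on the index only through a power of [z ^+ 2], hence
    modulo [d]. It is usable only inside a block: [1 - z ^+ 2 * x k] vanishes when [k.+1 = d]. *)
Let gS_block l k : (k.+1 < d)%N -> g (l * d + k.+1) =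
  - ((1 - (z * x k) ^+ 2) * (1 + z * x k) * (z * x k) ^+ 3)
  / ((1 - z ^+ 2 * x k) * (1 + z ^+ 2 * x k) * (1 + (z ^+ 2 * x k) ^+ 2) ^+ 2)
  * g (l * d + k).
Proof.
move=> kd.
have xk : x (l * d + k) = x k.
  by rewrite /x exprD (mulnC l) exprM (exprAC z) zd !expr1n mul1r.
rewrite addnS /g cq_denS; have e := cq_numS z (l * d + k)%N.
rewrite /x in xk; rewrite xk -/(x k) in e *.
rewrite -[cq_num z (_ + _).+1](mulKf (nz1 kd)) e.
by field; rewrite nz1 // nz2 nz3 (odd_root_cq_den d_odd).
Qed.

Let g0 : g 0 = 1.
Proof.
rewrite /g /cq_num /cq_den !qpoch0 !expr1n exp0n // muln0 !expr0 !mulr1.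
by rewrite invr1 mulr1.
Qed.

Let g_block l k : (k < d)%N -> g (l * d + k) = g (l * d) * g k.
Proof.
elim: k => [|k IH] kd; first by rewrite addn0 g0 mulr1.
have e0 := gS_block 0 kd; rewrite mul0n !add0n in e0.
by rewrite gS_block // e0 IH 1?ltnW // mulrCA.
Qed.

Let gS k : (k.+1 < d)%N -> g k.+1 =
  - ((1 - (z * x k) ^+ 2) * (1 + z * x k) * (z * x k) ^+ 3)
  / ((1 - z ^+ 2 * x k) * (1 + z ^+ 2 * x k) * (1 + (z ^+ 2 * x k) ^+ 2) ^+ 2)
  * g k.
Proof. by move=> kd; have := gS_block 0 kd; rewrite mul0n !add0n. Qed.

Let g_vanish k : (m < k < d)%N -> g k = 0.
Proof.
case/andP; elim: k => // k IH; rewrite ltnS leq_eqVlt => /orP[/eqP mk|mk] kd.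
  (* The ratio at index [m] is 0, because [z * x m = z ^+ d = 1]. *)
  rewrite gS // -mk /x -exprM -exprS -/d mul2n zd.
  by rewrite expr1n subrr !mul0r oppr0 !mul0r.
by rewrite gS // IH ?mulr0 // ltnW.
Qed.

(** The two sequences have equal ratios: the factor [- z] of [b - p * x k] cancels the one of
    [b - a * (p * x k) ^+ 2]. *)
Let g_wp k : (k < d)%N -> g k = wp_coef z (- z) (z ^+ 2) k.
Proof.
elim: k => [|k IH] kd.
  by rewrite g0 /wp_coef big_ord0.
have z0 : z != 0 := p_neq0 (ltn0Sn _) zd.
have := nz1 kd; have := nz2 k; have := nz3 k.
rewrite gS // IH 1?ltnW // wp_coefS -/(x k).
set X := x k => h3 h2 h1.
have h4 : 1 - (z ^+ 2 * X) ^+ 2 != 0.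
  rewrite (_ : _ - _ = (1 - z ^+ 2 * X) * (1 + z ^+ 2 * X)); last by ring.
  by rewrite mulf_neq0.
have h5 : - z - z * (z ^+ 4 * X ^+ 2) != 0.
  rewrite (_ : _ - _ = - z * (1 + (z ^+ 2 * X) ^+ 2)); last by ring.
  by rewrite mulf_neq0 ?oppr_eq0.
have h6 : 1 - z * - z * z ^+ 2 * X ^+ 2 != 0.
  by rewrite (_ : _ - _ = 1 + (z ^+ 2 * X) ^+ 2) //; ring.
by field; rewrite h1 h2 h4 h5 h6.
Qed.

Let c k := g k * qint z (6 * k + 1).

Let z_neq1 : z != 1.
Proof.
have := @prim_sub_neq0 1 1 (coprimen1 _); rewrite muln1 subr_eq0 eq_sym; apply.
by move: m_gt0; rewrite /d -addnn; lia.
Qed.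

(** Multiplying by [1 - z] turns the q-integer into [1 - z ^+ (6 * k + 1)], the factor
    [1 - a * (p ^+ k) ^+ 3] of [wp_term]; the sum terminates as [a * p ^+ m = z ^+ d = 1]. *)
Lemma cq_root_sum0 : \sum_(k < m.+1) c k = 0.
Proof.
have z1 : 1 - z != 0 by rewrite subr_eq0 eq_sym.
apply: (mulIf z1); rewrite mul0r mulr_suml.
rewrite -[RHS](@wp_sum_eq0 F d (ltn0Sn _) two_neq0 (z ^+ 2) _ m m.+1 z (- z)) //.
- apply: eq_bigr => k _; rewrite /wp_term -g_wp; last first.
    by rewrite (leq_trans (ltn_ord k)) // /d ltnS -addnn leq_addr.
  rewrite /c qintE // -mulrA divfK // mulrC; congr ((1 - _) * _).
  by rewrite addn1 exprS -!exprM; congr (_ * _ ^+ _); lia.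
- by rewrite exprAC zd expr1n.
- by rewrite exprNn zd mulr1 -signr_odd d_odd expr1.
- by rewrite -exprM mul2n -exprS zd.
(* Here [j] may reach [m.+1], which is below [d] because [m] is positive; 4 is coprime to the odd
   [d]. *)
- move=> j /andP[j0 jm]; rewrite -!exprM (_ : 2 * _ = 2 * 2 * j)%N; last by lia.
  rewrite prim_sub_neq0 //.
    by rewrite (coprimeMr d 2 2) d_coprime2.
  by rewrite j0 (leq_ltn_trans jm) // /d ltnS -addnn -[m.+1]add1n leq_add2r.
Qed.

Lemma cq_root_convolution L :
  \sum_(k < L * d) \sum_(j < k.+1) c j * c (k - j)%N = 0.
Proof.
apply: (@convolution_sum_eq0 _ m c (fun l => g (l * d))); last exact: cq_root_sum0.
- move=> l k kd; rewrite /c g_block // -mulrA; congr (_ * (_ * _)).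
  rewrite !qintE // mulnDr -addnA exprD mulnA (mulnC _ d) exprM zd expr1n.
  by rewrite mul1r.
- by move=> k hk; rewrite /c g_vanish ?mul0r.
Qed.

End PrimitiveRoot.

(** * Values of rational functions at algebraic numbers *)

(* [A] is regular at the points of [S], with value [v z] at [z]; one fraction
   has to serve all the points at once. *)
Definition specializes (S : algC -> Prop) (A : ratfun) (v : algC -> algC) :=
  exists A1 A2 : {poly int}, [/\ A2 != 0, A = tofrac A1 / tofrac A2 &
    forall z, S z -> ev z A2 != 0 /\ ev z A1 = v z * ev z A2].

Section Specializes.

Variable S : algC -> Prop.

Lemma specializesD A B v w : specializes S A v -> specializes S B w ->
  specializes S (A + B) (fun z => v z + w z).
Proof.
move=> [A1 [A2 [nA -> hA]]] [B1 [B2 [nB -> hB]]].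
exists (A1 * B2 + B1 * A2), (A2 * B2); split; first by rewrite mulf_neq0.
  by rewrite tofracD !tofracM addf_div ?tofrac_eq0.
move=> z Sz; have [a2 a1] := hA z Sz; have [b2 b1] := hB z Sz.
by rewrite rmorphD !rmorphM a1 b1 mulf_neq0 //; split => //; ring.
Qed.

Lemma specializesM A B v w : specializes S A v -> specializes S B w ->
  specializes S (A * B) (fun z => v z * w z).
Proof.
move=> [A1 [A2 [nA -> hA]]] [B1 [B2 [nB -> hB]]].
exists (A1 * B1), (A2 * B2); split; first by rewrite mulf_neq0.
  by rewrite !tofracM mulf_div.
move=> z Sz; have [a2 a1] := hA z Sz; have [b2 b1] := hB z Sz.
by rewrite !rmorphM a1 b1 mulf_neq0 //; split => //; ring.
Qed.

Lemma specializes_sum n (A : nat -> ratfun) v :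
  (forall k, specializes S (A k) (v k)) ->
  specializes S (\sum_(k < n) A k) (fun z => \sum_(k < n) v k z).
Proof.
move=> hA; elim: n => [|n [A1 [A2 [nA eA zA]]]].
  exists 0, 1; split; rewrite ?oner_neq0 ?big_ord0 ?tofrac0 ?mul0r // => z _.
  by rewrite big_ord0 rmorph0 rmorph1 oner_neq0 mul0r.
have := @specializesD _ _ _ _ (ex_intro _ A1 (ex_intro _ A2 (And3 nA eA zA))) (hA n).
rewrite -(big_ord_recr n (fun k => A k)) => -[B1 [B2 [nB eB zB]]].
exists B1, B2; split=> // z Sz; have [? ->] := zB z Sz.
by rewrite big_ord_recr.
Qed.

End Specializes.

Lemma algC_two_neq0 : (-1 : algC) != 1.
Proof. by rewrite eq_sym -addr_eq0 -[1 + 1]/(2%:R) pnatr_eq0. Qed.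

Lemma specializes_cq n k : odd n ->
  specializes (fun z => z ^+ n = 1) (cq k)
    (fun z => cq_num z k / cq_den z k * qint z (6 * k + 1)).
Proof.
move=> n_odd; exists (cq_num 'X k * qint 'X (6 * k + 1)), (cq_den 'X k).
split; [exact: cq_den_neq0 | exact: cqE |] => z zn.
have two_neq0 := algC_two_neq0.
have nz := odd_root_cq_den n_odd zn two_neq0 k.
rewrite rmorph_cq_den rmorphM rmorph_cq_num rmorph_qint evX; split=> //.
by rewrite [RHS]mulrAC divfK.
Qed.

(** * From roots of [n] to divisibility and coprimality in Z[q] *)

Lemma qint_poly (R : nzRingType) n : \sum_(i < n) 'X^i = \poly_(i < n) (1 : R).
Proof. by rewrite poly_def; apply: eq_bigr => i _; rewrite scale1r. Qed.

Lemma qint_monic n : (0 < n)%N -> qint ('X : {poly int}) n \is monic.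
Proof.
by case: n => // n _; rewrite monicE /qint qint_poly lead_coef_poly.
Qed.

Lemma size_qint n : size (qint ('X : {poly int}) n) = n.
Proof. by rewrite /qint qint_poly size_poly_eq ?oner_neq0. Qed.

(** Division by a monic polynomial stays in Z[q]; the remainder vanishes at all points of [s], too
    many for its degree. *)
Lemma zdvdp_roots (P A : {poly int}) (s : seq algC) :
    P \is monic -> uniq s -> (size P <= (size s).+1)%N ->
    {in s, forall z, ev z P = 0 /\ ev z A = 0} ->
  zdvdp P A.
Proof.
move=> Pmon us Ps hs; exists (Pdiv.Ring.rdivp A P).
have eA := Pdiv.RingMonic.rdivp_eq Pmon A.
rewrite {1}eA; set r := Pdiv.Ring.rmodp A P in eA *.
suff -> : r = 0 by rewrite addr0.
have szr : (size r <= size s)%N.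
  by rewrite -ltnS (leq_trans _ Ps) // Pdiv.Ring.ltn_rmodpN0 // monic_neq0.
apply: contraTeq szr => r0; rewrite -ltnNge.
have r0' : map_poly intr r != 0 :> {poly algC}.
  by rewrite map_poly_eq0_id0 // intr_eq0 lead_coef_eq0.
have := max_poly_roots r0' _ us; rewrite size_map_poly_id0 ?intr_eq0 ?lead_coef_eq0 //; apply.
apply/allP => z zs; have [zP zA] := hs z zs.
rewrite /root -[_.[z]]/(ev z r); have := congr1 (ev z) eA.
by rewrite rmorphD rmorphM zP mulr0 add0r zA => <-.
Qed.

(** A divisor of a monic polynomial has a unit leading coefficient, so a common divisor is a unit or
    has a root, which [P] and [A] would share. *)
Lemma zcoprimep_roots (P A : {poly int}) :
    P \is monic -> (forall z : algC, ev z P = 0 -> ev z A != 0) ->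
  zcoprimep P A.
Proof.
move=> Pmon hP D [B eP] [C eA].
have uD : lead_coef D \is a GRing.unit.
  apply/unitrPr; exists (lead_coef B).
  by rewrite mulrC -lead_coefM -eP (monicP Pmon).
have [sD|/closed_rootP[z]] := eqVneq (size (map_poly intr D : {poly algC})) 1%N.
  have sD1 : size D = 1%N.
    rewrite -sD size_map_poly_id0 // intr_eq0.
    by apply: contraTneq uD => ->.
  by rewrite poly_unitE sD1 eqxx /= -[D`_0]/(D`_(1.-1)%N) -{1}sD1.
rewrite /root -[_.[z]]/(ev z D) => /eqP zD.
have := hP z; rewrite eP eA !rmorphM zD !mulr0 eqxx => /(_ erefl).
by [].
Qed.

Theorem theorem1 (n : nat) (hn : odd n) :
  ratfun_cong (\sum_(k < n) aq k) 0 (qint ('X : {poly int}) n).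
Proof.
have n_gt0 : (0 < n)%N by case: n hn.
have two_neq0 := algC_two_neq0.
(* One fraction, regular at all [n]-th roots of unity, serves for both divisibility and
   coprimality. *)
have [A1 [A2 [nA eA zA]]] := specializes_sum n (fun k => specializes_sum k.+1
  (fun j => specializesM (specializes_cq j hn) (specializes_cq (k - j) hn))).
have qint_root (z : algC) : ev z (qint 'X n) = 0 -> z ^+ n = 1.
  rewrite rmorph_qint evX => e; apply/eqP; rewrite -subr_eq0 subrX1.
  by rewrite -/(qint z n) e mulr0.
exists A1, A2; split=> //; first by rewrite subr0.
  have [w w_prim] := C_prim_root_exists n_gt0.
  (* The [n - 1] nontrivial [n]-th roots of unity are as many as the degree of [n]. *)
  apply: (@zdvdp_roots _ _ [seq w ^+ i | i <- iota 1 n.-1]).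
  - exact: qint_monic.
  - rewrite map_inj_in_uniq ?iota_uniq // => i j.
    rewrite !mem_iota !add1n !prednK // => /andP[_ i_n] /andP[_ j_n] /eqP.
    by rewrite (eq_prim_root_expr w_prim) !modn_small // => /eqP.
  - by rewrite size_qint size_map size_iota prednK.
  move=> z /mapP[i]; rewrite mem_iota add1n prednK // => /andP[i0 i_n] ->.
  have zn : (w ^+ i) ^+ n = 1 by rewrite exprAC (prim_expr_order w_prim) expr1n.
  have z1 : w ^+ i != 1 by rewrite -(prim_order_dvd w_prim) gtnNdvd.
  move: (w ^+ i) zn z1 => {i0 i_n} y yn y1; split.
    by rewrite rmorph_qint evX qintE // yn subrr mul0r.
  have [_ ->] := zA y yn.
  (* The order [d] of [y] divides [n], so it is odd, and [y != 1] excludes [d = 1]; thus [n] is a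
     whole number of blocks of length [d]. *)
  have [d y_prim /dvdnP[L eL]] := prim_order_exists n_gt0 yn.
  have d_odd : odd d by move: hn; rewrite eL oddM => /andP[].
  have d_half : d = d./2.*2.+1 by rewrite -[LHS]odd_double_half d_odd.
  rewrite d_half in y_prim eL; rewrite [X in X * _](_ : _ = 0) ?mul0r //.
  rewrite eL; apply: cq_root_convolution => //.
  rewrite lt0n; apply: contraNneq y1 => m0; rewrite m0 in y_prim.
  by rewrite -(prim_expr_order y_prim) expr1.
apply: zcoprimep_roots; first exact: qint_monic.
by move=> z /qint_root /zA[].
Qed.
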